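(* Every quasi-independence model that arises from a toric matrix Schubert variety has rational maximum likelihood estimate. That is, if $w\in S_n$ is such that $Y_w$ is toric and $\mathcal M_S$ is the quasi-independence model associated to $\overline{X_w}$, then the maximum likelihood estimate for $\mathcal M_S$ is a rational function of the data.
   Context: Matrix Schubert side: $w\in S_n$ is identified with the permutation matrix having $1$s at $(w(j),j)$; $\overline{X_w}=\overline{BwB}\subseteq\mathbb C^{n\times n}$, with $B$ the upper triangular invertible matrices. $D^\circ(w)=\{(i,j): w(j)<i,\ w^{-1}(i)>j\}$; $\mathrm{Ess}(w)$ is the set of north-east corners of the connected components of $D^\circ(w)$; $\mathrm{dom}(w)$ is the connected component of $D^\circ(w)$ containing $(n,1)$ (possibly empty); $\mathrm{SW}(w)$ is the set of cells weakly south-west of some element of $\mathrm{Ess}(w)$; $L(w)=\mathrm{SW}(w)\setminus\mathrm{dom}(w)$, $L'(w)=\mathrm{SW}(w)\setminus D^\circ(w)$. $Y_w$ is the projection of $\overline{X_w}$ to the coordinates in $L(w)$, so $\overline{X_w}\cong Y_w\times\mathbb C^{n^2-|\mathrm{SW}(w)|}$. $Y_w$ is toric (for the torus $T\times T$ of pairs of diagonal matrices acting by $(X,Y)\cdot M=XMY^{-1}$) if and only if $L'(w)$ consists of disjoint hooks not sharing a row or a column, where a hook with corner $(i,j)$ consists of the corner together with cells directly north of it in column $j$ and cells directly east of it in row $i$. Quasi-independence models: for a state space $S\subseteq[m]\times[n']$ define $\phi^S:\mathbb R^{m+n'}\to\mathbb R^S$ by $\phi^S_{ij}(s,t)=s_it_j$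 for $(i,j)\in S$; the quasi-independence model is $\mathcal M_S=\phi^S(\mathbb R^{m+n'})\cap\Delta_{|S|-1}$, with $\Delta_{|S|-1}$ the probability simplex in $\mathbb R^S$. The bipartite graph associated to $S$ has an edge between $i$ and $j$ for each $(i,j)\in S$. Association: let $w$ be such that $Y_w$ is toric, with hooks $L_1'(w),\dots,L_k'(w)$ and corresponding disjoint parts $L_1(w),\dots,L_k(w)$ of $L(w)$ (where $L_i(w)$ is the connected component of $L(w)$ containing $L_i'(w)$). Each $L_i(w)$, whose hook occupies, say, $m$ rows and $n'$ columns, gives a quasi-independence model $\mathcal M_{S_i}$ on variables with states the rows ($[m]$ after relabelling) and columns ($[n']$ after relabelling) and state space $S_i=\{(x,y)\in L_i(w)\}$; the model associated to $\overline{X_w}$ is given by the disjoint union of these, i.e. its state space is $S=L(w)$ and its bipartite graph is the graph with edges $a - b^*$ for $(a,b)\in L(w)$. Maximum likelihood: given data from a model $\mathcal M$ (a vector of counts $u\in\mathbb N^S$), the maximum likelihood estimate is the $\hat p\in\mathcal M$ maximizing the likelihood function $L(p\mid u)=\prod_{s\in S}p_s^{u_s}$ (up to a constant), if the maximum exists. The model has rational maximum likelihood estimate if $\hat p$ can be written as a rational function of the data $u$. *)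

(* Defs.v *)
From mathcomp Require Import all_boot all_order all_algebra all_fingroup.
From mathcomp.real_closed Require Import complex.
From mathcomp Require Import reals.
From mathcomp Require Import mpoly.

Set Implicit Arguments.
Unset Strict Implicit.
Unset Printing Implicit Defensive.

Import GRing.Theory Num.Theory.
Local Open Scope ring_scope.

(* Matrix positions (row, column), numbered from 0: north is smaller row index,
   east is larger column index. *)
Notation cell n := ('I_n * 'I_n)%type.

Section Diagrams.
Variables (n : nat) (w : 'S_n).

(* w i is the row of the 1 in column i, and (w^-1) i the column of the 1 in
   row i. *)
Definition Dcirc : {set cell n} :=
  [set c : cell n | (w c.2 < c.1)%N && (c.2 < (w^-1)%g c.1)%N].

Definition adjacent (c d : cell n) : bool :=
  ((c.1 == d.1) && ((c.2.+1 == d.2 :> nat) || (d.2.+1 == c.2 :> nat)))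
  || ((c.2 == d.2) && ((c.1.+1 == d.1 :> nat) || (d.1.+1 == c.1 :> nat))).

Definition Dcirc_connected : rel (cell n) :=
  connect [rel c d : cell n | [&& c \in Dcirc, d \in Dcirc & adjacent c d]].

(* The neighbours of a cell of Dcirc that lie in its component are those that
   lie in Dcirc. *)
Definition Ess : {set cell n} :=
  [set c : cell n in Dcirc |
     [forall i : 'I_n, (i.+1 == c.1 :> nat) ==> ((i, c.2) \notin Dcirc)]
  && [forall j : 'I_n, (c.2.+1 == j :> nat) ==> ((c.1, j) \notin Dcirc)]].

Definition dom : {set cell n} :=
  [set c : cell n in Dcirc | [exists d : cell n in Dcirc,
     [&& d.1 == n.-1 :> nat, d.2 == 0%N :> nat & Dcirc_connected d c]]].

Definition SW : {set cell n} :=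
  [set c : cell n | [exists e : cell n in Ess, (e.1 <= c.1)%N && (c.2 <= e.2)%N]].

Definition L : {set cell n} := SW :\: dom.

End Diagrams.

Section MatrixSchubert.
Variables (K : fieldType) (n : nat).

Definition zariski_closure (A : 'M[K]_n -> Prop) (M : 'M[K]_n) : Prop :=
  forall f : {mpoly K[n * n]},
    (forall N, A N -> f.@[mxvec N 0] = 0) -> f.@[mxvec M 0] = 0.

Definition upper_triangular (b : 'M[K]_n) : Prop :=
  forall i j : 'I_n, (j < i)%N -> b i j = 0.

Definition borel (b : 'M[K]_n) : Prop := b \in unitmx /\ upper_triangular b.

Definition torus (t : 'M[K]_n) : Prop := t \in unitmx /\ is_diag_mx t.

(* 1s at (w j, j); this is the transpose of the library's perm_mx w. *)
Definition schubert_perm_mx (w : 'S_n) : 'M[K]_n :=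
  \matrix_(i, j) (i == w j)%:R.

Definition matrix_schubert (w : 'S_n) : 'M[K]_n -> Prop :=
  zariski_closure (fun M => exists b c,
    [/\ borel b, borel c & M = b *m schubert_perm_mx w *m c]).

(* K^A is realised as the coordinate subspace of the matrices supported on A,
   on which a torus pair (X, Y) still acts by M |-> X M Y^-1. *)
Definition coord_proj (A : {set cell n}) (M : 'M[K]_n) : 'M[K]_n :=
  \matrix_(i, j) (if (i, j) \in A then M i j else 0).

Definition Yvar (w : 'S_n) (M : 'M[K]_n) : Prop :=
  exists2 N, matrix_schubert w N & M = coord_proj (L w) N.

Definition torus_orbit (M N : 'M[K]_n) : Prop :=
  exists X Y, [/\ torus X, torus Y & N = X *m M *m invmx Y].

(* The torus T x T has a dense orbit. *)
Definition Y_toric (w : 'S_n) : Prop :=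
  exists2 M, Yvar w M &
    forall N, Yvar w N -> zariski_closure (torus_orbit M) N.

End MatrixSchubert.

Section QuasiIndependence.
Variables (R : realType) (m n : nat) (S : {set 'I_m * 'I_n}).

Local Notation state := {c in S}.

Definition simplex (p : state -> R) : Prop :=
  (forall c, 0 <= p c) /\ \sum_c p c = 1.

Definition qi_param (s : 'I_m -> R) (t : 'I_n -> R) (c : state) : R :=
  s (val c).1 * t (val c).2.

Definition qi_model (p : state -> R) : Prop :=
  (exists s t, p =1 qi_param s t) /\ simplex p.

Definition likelihood (u : state -> nat) (p : state -> R) : R :=
  \prod_c p c ^+ u c.

Definition is_mle (u : state -> nat) (p : state -> R) : Prop :=
  qi_model p /\ forall q, qi_model q -> likelihood u q <= likelihood u p.

(* Polynomials in the data have one variable per state. *)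
Definition at_data (f : {mpoly R[#|{: state}|]}) (u : state -> nat) : R :=
  f.@[fun k => (u (enum_val k))%:R].

(* The coordinate of the estimate at c is the rational function f c / g c.  It
   is required to be defined, and the estimate to exist, for all positive data;
   for data with zero counts the likelihood may have no maximizer in the model,
   or several.  The model of an empty state space is empty. *)
Definition has_rational_mle : Prop :=
  (S != set0 -> forall u : state -> nat, (forall c, (0 < u c)%N) ->
     exists p, is_mle u p) /\
  exists f g : state -> {mpoly R[#|{: state}|]},
    (forall u, (forall c, (0 < u c)%N) -> forall c, at_data (g c) u != 0) /\
    (forall u p, is_mle u p -> forall c, at_data (g c) u != 0 ->
       p c = at_data (f c) u / at_data (g c) u).

End QuasiIndependence.

(* Main.v *)
Require Import Defs.
From mathcomp Require Import all_boot all_order all_algebra all_fingroup.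
From mathcomp.real_closed Require Import complex.
From mathcomp Require Import reals.
From mathcomp Require Import mpoly exp zify ring.

(* A torus orbit has constant cross-ratios M_ij M_i'j' / (M_i'j M_ij'), so a dense orbit forces
   every cross-ratio of entries in L(w) to be constant on Y_w.  Comparing the two points E P E and
   (E + E_(f,w(l2))) P E of BwB, where E is the all-ones upper triangular matrix, shows that at
   most one dot (w(l), l) lies south-west of an essential cell.  Hence every cell of L(w) has a
   unique dot to its south-west, cells sharing a row or a column have the same dot, and the cells
   with a given dot form a staircase (Ferrers) shape.  For such a state space the likelihood
   equations can be solved row by row, from north to south: with r_i, c_j the margins of the data,
   N its total, and t_i the total of the data in the columns of row i and the rows >= i, the
   estimate is
     p_ij = r_i c_j / (N t_i) * prod_(k < i, (k, j) in S) (1 - r_k / t_k). *)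

Set Implicit Arguments.
Unset Strict Implicit.
Unset Printing Implicit Defensive.

Import Order.TTheory GRing.Theory Num.Theory.
Local Open Scope ring_scope.

(** * Dots of the permutation matrix and the shape of [L w] *)

Section Dots.
Variables (n : nat) (w : 'S_n).
Implicit Types (c d e : cell n) (i j l : 'I_n).

(** The number of such [l] is the rank of the part of the permutation matrix weakly south-west of
    [c]. *)
Definition dot_sw c l : bool := (c.1 <= w l)%N && (l <= c.2)%N.

(** For [c] in [Dcirc w] the dot in the row of [c] is strictly east of it and the dot in its column
    is strictly north, so neither is south-west. *)
Lemma dot_sw_Dcirc c l : c \in Dcirc w -> dot_sw c l -> (c.1 < w l)%N && (l < c.2)%N.
Proof.
rewrite inE /dot_sw => /andP[wc cw] /andP[cl lc]; apply/andP; split.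
  rewrite ltn_neqAle cl andbT; apply: contraTneq cw => E.
  by rewrite -leqNgt (val_inj E) permK.
rewrite ltn_neqAle lc andbT; apply: contraTneq wc => E.
by rewrite -leqNgt -(val_inj E).
Qed.

(** Nothing is strictly south-west of the corner. Along a path in [Dcirc w], a dot south-west of the
    next cell is strictly so, hence weakly south-west of the current one. *)
Lemma dom_no_dot c l : c \in Defs.dom w -> ~~ dot_sw c l.
Proof.
rewrite !inE => /andP[_ /existsP[d /and4P[dD /eqP d1 /eqP d2 /connectP[p]]]].
have : ~~ dot_sw d l.
  apply/negP => dl; have := dot_sw_Dcirc dD dl.
  by rewrite d2 ltn0 andbF.
elim: p d {dD d1 d2} => [|a p IHp] d /= dl => [_ -> //|/andP[/and3P[dD aD]]].
move=> adj; apply: IHp; apply: contra dl => al.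
have /andP[al1 al2] := dot_sw_Dcirc aD al.
rewrite /dot_sw.
by case/orP: adj => /andP[/eqP E /orP[]/eqP F]; move: al1 al2 F; rewrite E; lia.
Qed.

Lemma no_dot_Dcirc c : (forall l, ~~ dot_sw c l) -> c \in Dcirc w.
Proof.
move=> nodot; rewrite inE !ltnNge; apply/andP; split.
  by apply: contra (nodot c.2) => h; rewrite /dot_sw h leqnn.
by apply: contra (nodot ((w^-1)%g c.1)) => h; rewrite /dot_sw permKV leqnn.
Qed.

(** Walk west to the first column, then south to the corner: no cell on the way has a dot to its
    south-west, so all lie in [Dcirc w]. *)
Lemma no_dot_dom c : (forall l, ~~ dot_sw c l) -> c \in Defs.dom w.
Proof.
have sw (a b : cell n) : (a.1 <= b.1)%N -> (b.2 <= a.2)%N ->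
    (forall l, ~~ dot_sw a l) -> forall l, ~~ dot_sw b l.
  move=> h1 h2 na l; apply: contra (na l) => /andP[b1 b2].
  by rewrite /dot_sw (leq_trans h1 b1) (leq_trans b2 h2).
move=> nodot; have cD := no_dot_Dcirc nodot; rewrite inE cD /=.
suff [d [dD d1 d2 dc]] : exists d : cell n,
    [/\ d \in Dcirc w, d.1 = n.-1 :> nat, d.2 = 0%N :> nat
      & Dcirc_connected w d c].
  by apply/existsP; exists d; rewrite dD d1 d2 !eqxx.
move Ek: (n.-1 - c.1 + c.2)%N => k.
elim: k c nodot cD Ek => [|k IHk] c nodot cD Ek.
  exists c; split=> //; try exact: connect0; case: c Ek {nodot cD} => [[a la] [b lb]] /=; lia.
have step (d : cell n) : (c.1 <= d.1)%N -> (d.2 <= c.2)%N -> adjacent d c ->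
    (n.-1 - d.1 + d.2)%N = k -> exists d : cell n,
    [/\ d \in Dcirc w, d.1 = n.-1 :> nat, d.2 = 0%N :> nat
      & Dcirc_connected w d c].
  move=> h1 h2 adj dk.
  have nd := sw _ _ h1 h2 nodot; have dD := no_dot_Dcirc nd.
  have [e [eD e1 e2 ed]] := IHk d nd dD dk.
  exists e; split=> //; apply: connect_trans ed _; apply: connect1.
  by rewrite /= dD cD adj.
have [c20|c2pos] := posnP c.2.
  have lt1 : (c.1.+1 < n)%N by rewrite c20 addn0 in Ek; move: Ek; lia.
  apply: (step (Ordinal lt1, c.2)) => //=.
    by rewrite /adjacent /= !eqxx !orbT.
  by move: Ek; lia.
have lt2 : (c.2.-1 < n)%N by rewrite (leq_ltn_trans (leq_pred _)).
apply: (step (c.1, Ordinal lt2)) => //=; first exact: leq_pred.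
  by rewrite /adjacent /= prednK // !eqxx.
by move: Ek c2pos; lia.
Qed.

Lemma mem_L c : (c \in L w) = (c \in SW w) && [exists l, dot_sw c l].
Proof.
rewrite in_setD andbC; congr andb; apply/idP/existsP => [cd|[l cl]].
  by apply/existsP; apply: contraNT cd => /existsPn; apply: no_dot_dom.
by apply: contraTN cl; apply: dom_no_dot.
Qed.

Lemma SW_sw c d : c \in SW w -> (c.1 <= d.1)%N -> (d.2 <= c.2)%N -> d \in SW w.
Proof.
rewrite !inE => /existsP[e /and3P[eE e1 e2]] h1 h2; apply/existsP; exists e.
by rewrite eE (leq_trans e1 h1) (leq_trans h2 e2).
Qed.

(** The only consequence of toricity used to solve the likelihood equations. *)
Definition Ess_rank_le1 : Prop :=
  forall e l l', e \in Ess w -> dot_sw e l -> dot_sw e l' -> l = l'.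

(** The dot [l] of [(i', j)] also serves [(i', j')]. This is clear if [j <= j']; otherwise an
    essential cell north-east of [(i, j)] sees both [l] and the dot of [(i, j')], so they
    coincide. *)
Lemma L_staircase : Ess_rank_le1 -> forall i i' j j', (i < i')%N ->
  (i, j) \in L w -> (i', j) \in L w -> (i, j') \in L w -> (i', j') \in L w.
Proof.
move=> rk1 i i' j j' ii'; rewrite !mem_L => /andP[ijS _].
move=> /andP[_ /existsP[l /andP[/= il lj]]] /andP[ij'S /existsP[l' /andP[/= il' lj']]].
rewrite (@SW_sw _ (i', j') ij'S (ltnW ii')) //=; apply/existsP; exists l.
rewrite /dot_sw il /=; case: (leqP j j') => [|j'j]; first exact: leq_trans.
move: ijS; rewrite inE => /existsP[e /and3P[eE /= e1 e2]].
rewrite (rk1 e l l') //; apply/andP; split.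
- by rewrite (leq_trans e1) // (leq_trans (ltnW ii')).
- exact: leq_trans e2.
- exact: leq_trans il'.
- by rewrite (leq_trans lj') // (leq_trans (ltnW j'j)).
Qed.

End Dots.

(** * Polynomial conditions on the closure of a torus orbit *)

Section DenseOrbit.
Variables (K : fieldType) (n : nat).
Implicit Types (M N : 'M[K]_n) (i j : 'I_n).

Lemma diag_invmx (Y : 'M[K]_n) : Y \in unitmx -> is_diag_mx Y -> is_diag_mx (invmx Y).
Proof.
move=> Yu /diag_mxP[d dY]; apply/is_diag_mxP => i j ij.
have := mulmxV Yu; rewrite {1}dY mul_diag_mx => /matrixP E.
have := E i i; rewrite !mxE eqxx => di.
have := E i j; rewrite !mxE -val_eqE (negbTE ij) => /eqP.
rewrite mulf_eq0 => /orP[/eqP d0|/eqP //].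
by move/eqP: di; rewrite d0 mul0r eq_sym oner_eq0.
Qed.

Lemma torus_orbitE M N : torus_orbit M N ->
  exists x y : 'I_n -> K, forall i j, N i j = x i * M i j * y j.
Proof.
move=> [X [Y [[_ /diag_mxP[x ->]] [Yu Yd] ->]]].
have /diag_mxP[y ->] := diag_invmx Yu Yd.
exists (x 0), (y 0) => i j.
by rewrite mul_diag_mx mul_mx_diag !mxE.
Qed.

Definition entry_poly i j : {mpoly K[n * n]} := 'X_(mxvec_index i j).

Lemma meval_entry i j M : (entry_poly i j).@[mxvec M 0] = M i j.
Proof. by rewrite mevalXU mxvecE. Qed.

Lemma orbit_entry_eq0 M N i j : zariski_closure (torus_orbit M) N ->
  M i j = 0 -> N i j = 0.
Proof.
move=> cl Mij; rewrite -meval_entry; apply: cl => N' /torus_orbitE[x [y E]].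
by rewrite meval_entry E Mij mulr0 mul0r.
Qed.

(** Equality of cross-ratios with denominators cleared, so that it is polynomial in [N]; on the
    orbit the row and column scalings cancel. *)
Lemma orbit_cross_ratio M N i i' j j' : zariski_closure (torus_orbit M) N ->
  M i' j * M i j' * (N i j * N i' j') = M i j * M i' j' * (N i' j * N i j').
Proof.
move=> cl; apply/eqP; rewrite -subr_eq0.
have := cl (M i' j * M i j' *: (entry_poly i j * entry_poly i' j')
  - M i j * M i' j' *: (entry_poly i' j * entry_poly i j')).
rewrite mevalB !mevalZ !mevalM !meval_entry => -> // N' /torus_orbitE[x [y E]].
by rewrite mevalB !mevalZ !mevalM !meval_entry !E; ring.
Qed.

End DenseOrbit.

(** * Explicit points of BwB and the consequence of toricity *)

Section BruhatPoints.
Variables (K : fieldType) (n : nat) (w : 'S_n).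
Implicit Types (b : 'M[K]_n) (i j : 'I_n).

Lemma borel_unitriangular b : upper_triangular b -> (forall i, b i i = 1) -> borel b.
Proof.
move=> ub b1; split=> //; rewrite unitmxE -det_tr det_trig; last first.
  by apply/is_trig_mxP => i j ij; rewrite mxE ub.
by rewrite big1 ?unitr1 // => i _; rewrite mxE.
Qed.

Definition ones_ut : 'M[K]_n := \matrix_(i, j) (i <= j)%:R.

Lemma borel_ones_ut : borel ones_ut.
Proof.
apply: borel_unitriangular => [i j ij|i]; rewrite mxE ?leqnn //.
by rewrite leqNgt ij.
Qed.

Lemma borel_ones_ut_add i j : (i < j)%N -> borel (ones_ut + delta_mx i j).
Proof.
move=> ij; apply: borel_unitriangular => [k l lk|k]; rewrite !mxE.
  rewrite leqNgt lk add0r; case: eqP => //= ?; case: eqP => //= ?; subst k l.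
  by rewrite ltnNge ltnW in lk.
rewrite leqnn; case: eqP => [->|]; rewrite ?addr0 //.
by case: eqP ij => [->|]; rewrite ?ltnn ?addr0.
Qed.

Lemma Yvar_borel b c M : borel b -> borel c -> M = b *m schubert_perm_mx K w *m c ->
  Yvar w (coord_proj (L w) M).
Proof.
move=> bb bc ->; exists (b *m schubert_perm_mx K w *m c) => // f; apply.
by exists b, c.
Qed.

Lemma mul_perm_ones_ut i j :
  (schubert_perm_mx K w *m ones_ut) i j = ((w^-1)%g i <= j)%:R.
Proof.
rewrite mxE (bigD1 ((w^-1)%g i)) //= big1 => [|l lj]; rewrite !mxE.
  by rewrite permKV eqxx mul1r addr0.
case: eqP => [E|]; last by rewrite mul0r.
by rewrite E permK eqxx in lj.
Qed.

Lemma ones_utE i j : (ones_ut *m schubert_perm_mx K w *m ones_ut) i j =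
  #|[set l | dot_sw w (i, j) l]|%:R.
Proof.
rewrite -mulmxA mxE (reindex_inj (@perm_inj _ w)) /=.
rewrite -sum1_card natr_sum [RHS]big_mkcond /=; apply: eq_bigr => l _.
rewrite mul_perm_ones_ut permK mxE inE /dot_sw /=.
by case: (i <= w l)%N; case: (l <= j)%N; rewrite ?mulr1 ?mul0r ?mulr0.
Qed.

End BruhatPoints.

(* If [l1 < l2] are both south-west of [e], adding row [w l2] of P E to row [e.1] changes only the
   entry at [e] among the four entries in rows [e.1], [w l1] and columns [l1], [e.2]. *)
Lemma toric_Ess_rank_le1 (K : numFieldType) (n : nat) (w : 'S_n) :
  Y_toric K w -> Ess_rank_le1 w.
Proof.
move=> [M0 _ dense] e l l' eE.
suff main (l1 l2 : 'I_n) : (l1 < l2)%N -> dot_sw w e l1 -> dot_sw w e l2 -> False.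
  move=> el el'; case: (ltngtP l l') => [h|h|/val_inj //].
    by case: (main _ _ h el el').
  by case: (main _ _ h el' el).
move=> l12 el1 el2; set f := e.1; set g := e.2.
have eD : e \in Dcirc w by move: eE; rewrite inE => /andP[].
have /andP[f1 g1] := dot_sw_Dcirc eD el1; have /andP[f2 g2] := dot_sw_Dcirc eD el2.
rewrite -/f -/g in f1 f2 g1 g2.
have inL (c : cell n) : (f <= c.1)%N -> (c.2 <= g)%N -> dot_sw w c l1 -> c \in L w.
  move=> h1 h2 cl; rewrite mem_L inE; apply/andP; split; apply/existsP; last by exists l1.
  by exists e; rewrite eE h1.
have L1 : (f, g) \in L w by apply: inL; rewrite //= /dot_sw /= ltnW //= ltnW.
have L2 : (f, l1) \in L w by apply: inL; rewrite /dot_sw /= ?(ltnW f1) ?(ltnW g1) ?leqnn.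
have L3 : (w l1, g) \in L w by apply: inL; rewrite /dot_sw /= ?(ltnW f1) ?(ltnW g1) ?leqnn.
have L4 : (w l1, l1) \in L w by apply: inL; rewrite /dot_sw /= ?(ltnW f1) ?(ltnW g1) ?leqnn.
pose E := ones_ut K n; pose P := schubert_perm_mx K w; pose N1 := E *m P *m E.
pose N2 := (E + delta_mx f (w l2)) *m P *m E.
have Y1 : Yvar w (coord_proj (L w) N1).
  by apply: Yvar_borel; [apply: borel_ones_ut..|].
have Y2 : Yvar w (coord_proj (L w) N2).
  by apply: Yvar_borel; [exact: borel_ones_ut_add f2|exact: borel_ones_ut|].
have projL N (c : cell n) : c \in L w -> coord_proj (L w) N c.1 c.2 = N c.1 c.2 :> K.
  by move=> cL; rewrite mxE -surjective_pairing cL.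
have N1n0 (c : cell n) : c \in L w -> N1 c.1 c.2 != 0.
  rewrite mem_L ones_utE pnatr_eq0 -lt0n -surjective_pairing => /andP[_ /existsP[l3 cl]].
  by apply/card_gt0P; exists l3; rewrite inE.
(* A zero entry of the dense point would be zero on all of Y_w, but E P E has no zero on [L w] in
   characteristic 0. *)
have M0n0 (c : cell n) : c \in L w -> M0 c.1 c.2 != 0.
  move=> cL; apply: contra (N1n0 c cL) => /eqP /(orbit_entry_eq0 (dense _ Y1)).
  by rewrite projL // => ->.
have N2E i j : N2 i j = N1 i j + ((i == f) && (l2 <= j)%N)%:R.
  have -> : N2 = N1 + delta_mx f (w l2) *m (P *m E) by rewrite /N2 !mulmxDl mulmxA.
  rewrite mxE; congr (_ + _); rewrite mxE (bigD1 (w l2)) //= big1 => [|k kl].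
    rewrite addr0 /P /E mul_perm_ones_ut permK mxE eqxx andbT.
    by case: eqP; rewrite ?mul1r ?mul0r.
  by rewrite mxE (negbTE kl) andbF mul0r.
have := orbit_cross_ratio f (w l1) g l1 (dense _ Y1).
have := orbit_cross_ratio f (w l1) g l1 (dense _ Y2).
rewrite (projL _ _ L1) (projL _ _ L2) (projL _ _ L3) (projL _ _ L4).
rewrite (projL _ _ L1) (projL _ _ L2) (projL _ _ L3) (projL _ _ L4) /=.
have wf : (w l1 == f) = false by apply/eqP => h; rewrite h ltnn in f1.
rewrite !N2E eqxx wf (ltnW g2) [(l2 <= l1)%N]leqNgt l12 /= !addr0 => h2 h1.
(* The two identities differ only by the 1 added to the entry at [e]; subtracting them leaves a
   product of three nonzero entries. *)
have : M0 (w l1) g * M0 f l1 * N1 (w l1) l1 = 0.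
  by move: h2; rewrite -h1; move/eqP; rewrite -subr_eq0 => /eqP <-; ring.
apply/eqP; rewrite !mulf_neq0 //; [exact: M0n0 L3|exact: M0n0 L2|exact: N1n0 L4].
Qed.

(** * Row and column margins *)

Section Margins.
Variables (m n : nat) (S : {set 'I_m * 'I_n}).
Local Notation state := {c in S}.

Section Nmodule.
Variable V : nmodType.
Implicit Types (x : state -> V) (i : 'I_m) (j : 'I_n).

(** Values in an arbitrary [nmodType] allow the same sums for numerical data and for the variables
    of a polynomial ring. *)
Definition row_sum x i : V := \sum_(c : state | (val c).1 == i) x c.
Definition col_sum x j : V := \sum_(c : state | (val c).2 == j) x c.

Definition tail_sum x i : V := \sum_(c : state | (i <= (val c).1)%N && ((i, (val c).2) \in S)) x c.

Lemma sum_row_sum x : \sum_i row_sum x i = \sum_c x c.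
Proof. by rewrite [RHS](partition_big (fun c : state => (val c).1) xpredT). Qed.

Lemma sum_col_sum x : \sum_j col_sum x j = \sum_c x c.
Proof. by rewrite [RHS](partition_big (fun c : state => (val c).2) xpredT). Qed.

Lemma sum_row_states (F : 'I_n -> V) i :
  \sum_(c : state | (val c).1 == i) F (val c).2 = \sum_(j | (i, j) \in S) F j.
Proof.
rewrite -(big_sub_cond (mem S) (fun c => c.1 == i) (fun c => F c.2)).
transitivity (\sum_(k | k == i) \sum_(j | (k, j) \in S) F j); last by rewrite big_pred1_eq.
rewrite pair_big_dep /=.
by apply: eq_big => [[a b]|//]; rewrite andbC.
Qed.

Lemma sum_col_states (F : 'I_m -> V) j :
  \sum_(c : state | (val c).2 == j) F (val c).1 = \sum_(i | (i, j) \in S) F i.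
Proof.
rewrite -(big_sub_cond (mem S) (fun c => c.2 == j) (fun c => F c.1)).
transitivity (\sum_(k | k == j) \sum_(i | (i, k) \in S) F i); last by rewrite big_pred1_eq.
rewrite (exchange_big_dep xpredT) //= pair_big_dep /=.
by apply: eq_big => [[a b]|//] /=; rewrite andbC.
Qed.

End Nmodule.

Lemma sum_margins (R : pzRingType) (x : state -> R) (a : 'I_m -> R) (b : 'I_n -> R) :
  \sum_c x c * (a (val c).1 + b (val c).2) =
  \sum_i row_sum x i * a i + \sum_j col_sum x j * b j.
Proof.
under eq_bigr do rewrite mulrDr.
rewrite big_split /=; congr (_ + _).
  rewrite (partition_big (fun c : state => (val c).1) xpredT) //=.
  by apply: eq_bigr => i _; rewrite mulr_suml; apply: eq_bigr => c /eqP->.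
rewrite (partition_big (fun c : state => (val c).2) xpredT) //=.
by apply: eq_bigr => i _; rewrite mulr_suml; apply: eq_bigr => c /eqP->.
Qed.

End Margins.

Lemma ln_lt_sub1 (R : realType) (y : R) : 0 < y -> y != 1 -> ln y < y - 1.
Proof.
move=> y0 y1; have := @expR_gt1Dx R (ln y); rewrite ln_eq0 // => /(_ y1).
by rewrite lnK // ltrBrDl.
Qed.

(** * Maximum likelihood from matching margins *)

Section Birch.
Variables (R : realType) (m n : nat) (S : {set 'I_m * 'I_n}).
Local Notation state := {c in S}.
Variable u : state -> nat.
Hypothesis u_gt0 : forall c, (0 < u c)%N.
Implicit Types (p q : state -> R).

Let x (c : state) : R := (u c)%:R.
Let N : R := \sum_c x c.

Definition log_likelihood q : R := \sum_c x c * ln (q c).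

Lemma likelihood_exp q : (forall c, 0 < q c) -> likelihood u q = sequences.expR (log_likelihood q).
Proof.
move=> q0; rewrite expR_sum; apply: eq_bigr => c _.
by rewrite expRM_natl lnK //; apply: q0.
Qed.

Lemma likelihood_pos q : simplex q -> 0 < likelihood u q -> forall c, 0 < q c.
Proof.
move=> [q0 _] Lq c; rewrite lt_neqAle q0 andbT; apply: contraTneq Lq => qc.
by rewrite /likelihood (bigD1 c) //= -qc expr0n eqn0Ngt u_gt0 mul0r ltxx.
Qed.

Lemma log_likelihood_margins p q : (forall i, row_sum p i * N = row_sum x i) ->
  (forall j, col_sum p j * N = col_sum x j) -> qi_model q -> (forall c, 0 < q c) ->
  log_likelihood q = N * \sum_c p c * ln (q c).
Proof.
move=> prow pcol [[s [t qst]] _] q0.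
(* The two parameters may both be negative, hence the absolute values. *)
have lnq c : ln (q c) = ln `|s (val c).1| + ln `|t (val c).2|.
  have := q0 c; rewrite qst => st0.
  have : s (val c).1 * t (val c).2 != 0 by rewrite gt_eqF.
  rewrite mulf_eq0 negb_or => /andP[s0 t0].
  by rewrite -lnM ?posrE ?normr_gt0 // -normrM gtr0_norm.
rewrite /log_likelihood.
under eq_bigr do rewrite lnq.
under [in RHS]eq_bigr do rewrite lnq.
rewrite (sum_margins x (fun i => ln `|s i|) (fun j => ln `|t j|)).
rewrite (sum_margins p (fun i => ln `|s i|) (fun j => ln `|t j|)).
rewrite mulrDr !mulr_sumr; congr (_ + _); apply: eq_bigr => i _.
  by rewrite -prow; ring.
by rewrite -pcol; ring.
Qed.

(* Birch's theorem: as [q] and [p] have log-linear coordinates, the difference of their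
   log-likelihoods only sees the margins, so it is -N times a Kullback-Leibler divergence. *)
Lemma log_likelihood_lt p q : 0 < N -> (forall i, row_sum p i * N = row_sum x i) ->
  (forall j, col_sum p j * N = col_sum x j) ->
  qi_model p -> (forall c, 0 < p c) -> qi_model q -> (forall c, 0 < q c) ->
  (exists c, q c != p c) -> log_likelihood q < log_likelihood p.
Proof.
move=> N0 prow pcol Mp p0 Mq q0 [c0 qp].
rewrite !(log_likelihood_margins prow pcol) // ltr_pM2l // -subr_lt0 -sumrB.
have D0 : \sum_c (q c - p c) = 0 by rewrite sumrB Mp.2.2 Mq.2.2 subrr.
(* This is [ln y <= y - 1] at [y = q c / p c], with its equality case; the right-hand sides sum to
   0. *)
have le c : p c * ln (q c) - p c * ln (p c) <= q c - p c ?= iff (q c == p c).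
  have -> : p c * ln (q c) - p c * ln (p c) = p c * ln (q c / p c).
    by rewrite ln_div ?posrE // mulrBr.
  have -> : q c - p c = p c * (q c / p c - 1).
    by rewrite mulrBr mulr1 mulrC divfK // gt_eqF.
  have [->|ne] := eqVneq (q c) (p c).
    by rewrite divff ?gt_eqF // ln1 subrr mulr0; apply/leif_refl.
  apply/leifP; rewrite ltr_pM2l //; apply: ln_lt_sub1; first exact: divr_gt0.
  by apply: contra ne => /eqP h; rewrite -[q c](divfK (lt0r_neq0 (p0 c))) h mul1r.
rewrite -[ltRHS]D0 (lt_leif (leif_sum (fun c (_ : xpredT c) => le c))) negb_forall.
by apply/existsP; exists c0.
Qed.

(** A competitor with a zero coordinate has likelihood 0, all counts being positive; any other one
    is compared through logarithms, strictly if it differs from [p]. *)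
Lemma margins_mle p : 0 < N -> (forall i, row_sum p i * N = row_sum x i) ->
  (forall j, col_sum p j * N = col_sum x j) -> qi_model p -> (forall c, 0 < p c) ->
  is_mle u p /\ forall q, is_mle u q -> q =1 p.
Proof.
move=> N0 prow pcol Mp p0.
have lt q : qi_model q -> (forall c, 0 < q c) -> (exists c, q c != p c) ->
    likelihood u q < likelihood u p.
  by move=> Mq q0 qp; rewrite !likelihood_exp // ltr_expR log_likelihood_lt.
have L0 : 0 < likelihood u p by rewrite likelihood_exp ?expR_gt0.
split=> [|q [Mq maxq] c].
  split=> // q Mq; case: (ltP 0 (likelihood u q)) => [Lq|Lq]; last first.
    exact: le_trans Lq (ltW L0).
  have q0 := likelihood_pos Mq.2 Lq.
  have [/existsP ne|/existsPn eq] := boolP [exists c, q c != p c].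
    exact: ltW (lt _ Mq q0 ne).
  rewrite le_eqVlt; apply/orP; left; apply/eqP/eq_bigr => c _.
  by congr (_ ^+ _); apply/eqP/negPn.
apply: contraTeq (maxq _ Mp) => ne; rewrite -ltNge lt //; last by exists c.
exact: likelihood_pos Mq.2 (lt_le_trans L0 (maxq _ Mp)).
Qed.

End Birch.

Lemma ler_sum_subpred (R : numDomainType) (I : finType) (P Q : pred I) (F : I -> R) :
  (forall i, 0 <= F i) -> (forall i, P i -> Q i) -> \sum_(i | P i) F i <= \sum_(i | Q i) F i.
Proof.
move=> F0 PQ; rewrite big_mkcond [leRHS]big_mkcond; apply: ler_sum => i _.
by have := PQ i; case: ifP => // [_ ->//|_ _]; case: ifP.
Qed.

(** * The closed-form estimate for a staircase *)

Section Staircase.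
Variables (m n : nat) (S : {set 'I_m * 'I_n}).
Local Notation state := {c in S}.
Hypothesis staircase : forall (i i' : 'I_m) (j j' : 'I_n), (i < i')%N ->
  (i, j) \in S -> (i', j) \in S -> (i, j') \in S -> (i', j') \in S.

Section Weights.
Variables (R : realFieldType) (x : state -> R).
Hypothesis x_gt0 : forall c, 0 < x c.

Let r := row_sum x.
Let t := tail_sum x.
Let N : R := \sum_c x c.

(** The fraction of each column of row [i] that is left once that row is fitted. For an empty row
    [t i = 0], and division by zero makes it 1. *)
Definition survival i : R := 1 - r i / t i.

(* The mass of column [j] that remains once its rows of index less than [k] have been fitted. *)
Definition rest (k : nat) (j : 'I_n) : R :=
  col_sum x j * \prod_(i : 'I_m | (i < k)%N && ((i, j) \in S)) survival i.

Definition staircase_mle (c : state) : R :=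
  rest (val c).1 (val c).2 * r (val c).1 / (N * t (val c).1).

Lemma row_le_tail i : r i <= t i.
Proof.
apply: ler_sum_subpred => [c|c /eqP <-]; first exact: ltW.
by rewrite leqnn -surjective_pairing (valP c).
Qed.

Lemma row_gt0 i j : (i, j) \in S -> 0 < r i.
Proof.
move=> ijS; rewrite /r /row_sum (bigD1 (exist _ (i, j) ijS)) //=.
by rewrite ltr_wpDr // sumr_ge0 // => c _; rewrite ltW.
Qed.

Lemma col_gt0 i j : (i, j) \in S -> 0 < col_sum x j.
Proof.
move=> ijS; rewrite /col_sum (bigD1 (exist _ (i, j) ijS)) //=.
by rewrite ltr_wpDr // sumr_ge0 // => c _; rewrite ltW.
Qed.

Lemma tail_gt0 i j : (i, j) \in S -> 0 < t i.
Proof. by move=> /row_gt0 ri; apply: lt_le_trans ri (row_le_tail i). Qed.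

Lemma tail_ge0 i : 0 <= t i.
Proof. by apply: sumr_ge0 => c _; apply: ltW. Qed.

(** The state [(i', j)] is counted in [t i] but not in [r i]. *)
Lemma row_lt_tail (i i' : 'I_m) j : (i < i')%N -> (i, j) \in S -> (i', j) \in S -> r i < t i.
Proof.
move=> ii' ijS i'jS; rewrite /t /tail_sum (bigD1 (exist _ (i', j) i'jS)) /=; last by rewrite ltnW.
rewrite addrC ltr_pwDr //; apply: ler_sum_subpred => [c|c /eqP E]; first exact: ltW.
rewrite -{1 2}E leqnn -surjective_pairing (valP c) /=.
by apply: contraTneq ii' => h; rewrite -E h /= ltnn.
Qed.

Lemma survival_ge0 i : 0 <= survival i.
Proof.
have := tail_ge0 i; rewrite le_eqVlt /survival => /orP[/eqP <-|ti].
  by rewrite invr0 mulr0 subr0 ler01.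
by rewrite subr_ge0 ler_pdivrMr // mul1r row_le_tail.
Qed.

Lemma survival_gt0 (i i' : 'I_m) j : (i < i')%N -> (i, j) \in S -> (i', j) \in S -> 0 < survival i.
Proof.
move=> ii' ijS i'jS.
by rewrite subr_gt0 ltr_pdivrMr ?(tail_gt0 ijS) // mul1r (row_lt_tail ii' ijS).
Qed.

Lemma rest0 j : rest 0 j = col_sum x j.
Proof. by rewrite /rest big_pred0 ?mulr1 // => i; rewrite ltn0. Qed.

Lemma rest_ge0 k j : 0 <= rest k j.
Proof.
by rewrite mulr_ge0 ?sumr_ge0 ?prodr_ge0 // => i _; rewrite ?survival_ge0 ?ltW.
Qed.

Lemma restS (k : 'I_m) j :
  rest k.+1 j = rest k j - (if (k, j) \in S then rest k j * (r k / t k) else 0).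
Proof.
rewrite /rest; case: ifP => kS; last first.
  rewrite subr0; congr (_ * _); apply: eq_bigl => i; rewrite ltnS leq_eqVlt.
  by case: eqP => // /val_inj ->; rewrite kS !andbF.
rewrite (bigD1 k) /=; last by rewrite leqnn.
rewrite (eq_bigl (fun i : 'I_m => (i < k)%N && ((i, j) \in S))) => [|i].
  by rewrite /survival; ring.
by rewrite ltnS ltn_neqAle -val_eqE andbC andbA.
Qed.

(* Fitting a row [k] disjoint from row [i] leaves the columns of [i] untouched; otherwise the
   columns of [k] are among those of [i], and fitting [k] removes exactly [r k] from them. *)
Lemma sum_rest k (i : 'I_m) : (k <= i)%N ->
  \sum_(j | (i, j) \in S) rest k j =
  \sum_(c : state | (k <= (val c).1)%N && ((i, (val c).2) \in S)) x c.
Proof.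
elim: k i => [|k IHk] i ki.
  under eq_bigr do rewrite rest0.
  rewrite [RHS](partition_big (fun c : state => (val c).2) (fun j => (i, j) \in S)) //=.
  by apply: eq_bigr => j ijS; apply: eq_bigl => c; case: eqP => [->|]; rewrite ?ijS ?andbF.
pose k' := Ordinal (ltn_trans ki (ltn_ord i)).
under eq_bigr do rewrite (restS k').
rewrite sumrB -big_mkcondr /= IHk ?(ltnW ki) //; apply/eqP; rewrite subr_eq addrC; apply/eqP.
rewrite (bigID (fun c : state => (val c).1 == k')) /=; congr (_ + _); last first.
  by apply: eq_bigl => c; rewrite andbAC ltn_neqAle -val_eqE eq_sym [X in X && _]andbC.
have [/existsP[j0 /andP[ij0 kj0]]|/existsPn no] :=
  boolP [exists j, ((i, j) \in S) && ((k', j) \in S)].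
  have sub j : (k', j) \in S -> (i, j) \in S by apply: staircase kj0 ij0.
  transitivity (r k').
    apply: eq_bigl => c; case: eqP => [E|]; rewrite ?andbF ?andbT //.
    have kS : (k', (val c).2) \in S by rewrite -E -surjective_pairing (valP c).
    by rewrite E /= leqnn sub.
  rewrite (eq_bigl (fun j => (k', j) \in S)) => [|j]; last exact/andb_idl/sub.
  rewrite -mulr_suml IHk //=; rewrite -[\sum_(_ | _) _]/(t k') mulrC divfK //.
  by rewrite gt_eqF ?(tail_gt0 kj0).
rewrite !big_pred0 // => [j|c]; first exact/negbTE.
apply/negP => /andP[/andP[_ h] /eqP E]; have /negP := no (val c).2; apply.
by rewrite h -E -surjective_pairing (valP c).
Qed.

Hypothesis S_neq0 : S != set0.

Lemma total_gt0 : 0 < N.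
Proof.
have [c cS] := set0Pn _ S_neq0.
rewrite /N (bigD1 (exist _ c cS)) //= ltr_wpDr // sumr_ge0 // => d _.
exact: ltW.
Qed.

(** By [sum_rest] at [k = i], the columns of row [i] still hold [t i] when that row is fitted, which
    cancels the denominator. *)
Lemma staircase_mle_row i : row_sum staircase_mle i * N = r i.
Proof.
rewrite /row_sum /staircase_mle.
rewrite (eq_bigr (fun c : state => rest i (val c).2 * (r i / (N * t i)))); last first.
  by move=> c /eqP->; rewrite mulrA.
rewrite -mulr_suml (sum_row_states S (rest i)) sum_rest // -[\sum_(_ | _) _]/(t i).
have N0 : N != 0 by rewrite gt_eqF ?total_gt0.
have [t0|t0] := eqVneq (t i) 0; last by field; rewrite N0 t0.
(* The row is empty: [r i] lies between 0 and [t i = 0]. *)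
rewrite t0 !mul0r; apply: le_anti; rewrite -{2}t0 row_le_tail andbT.
by apply: sumr_ge0 => c _; apply: ltW.
Qed.

Lemma rest_flow (j : 'I_n) :
  \sum_(i | (i, j) \in S) rest i j * (r i / t i) = col_sum x j - rest m j.
Proof.
rewrite -rest0 -opprB -(telescope_sumr (rest ^~ j)) // big_mkord -sumrN big_mkcond /=.
by apply: eq_bigr => i _; rewrite restS; case: ifP => _; ring.
Qed.

(** Over all columns, row [i] removes [r i] in total, and these amounts add up to the whole mass.
    What remains is nonnegative with sum 0. *)
Lemma rest_last j : rest m j = 0.
Proof.
suff : \sum_j rest m j = 0 by move/psumr_eq0P; apply=> // k _; apply: rest_ge0.
have -> : \sum_j rest m j =
    \sum_j col_sum x j - \sum_j \sum_(i | (i, j) \in S) rest i j * (r i / t i).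
  by rewrite -sumrB; apply: eq_bigr => k _; rewrite rest_flow subKr.
rewrite sum_col_sum (exchange_big_dep xpredT) //= -sum_row_sum -sumrB big1 // => i _.
rewrite -mulr_suml sum_rest // -[\sum_(c | (i <= _)%N && _) _]/(t i) -/(r i).
have [t0|t0] := eqVneq (t i) 0; last by rewrite mulrC divfK // subrr.
rewrite t0 mul0r subr0; apply: le_anti; rewrite -{1}t0 row_le_tail /=.
by apply: sumr_ge0 => c _; apply: ltW.
Qed.

Lemma staircase_mle_col j : col_sum staircase_mle j * N = col_sum x j.
Proof.
have N0 : N != 0 by rewrite gt_eqF ?total_gt0.
rewrite -[RHS]subr0 -(rest_last j) -rest_flow /col_sum mulr_suml.
rewrite -(sum_col_states S (fun i => rest i j * (r i / t i))).
apply: eq_bigr => c /eqP <-; rewrite /staircase_mle invfM; field.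
by rewrite N0 gt_eqF // (@tail_gt0 _ (val c).2) // -surjective_pairing (valP c).
Qed.

Lemma staircase_mle_gt0 c : 0 < staircase_mle c.
Proof.
have cS : ((val c).1, (val c).2) \in S by rewrite -surjective_pairing (valP c).
rewrite divr_gt0 ?mulr_gt0 ?total_gt0 ?(tail_gt0 cS) ?(row_gt0 cS) ?(col_gt0 cS) //.
by apply: prodr_gt0 => i /andP[ic iS]; apply: survival_gt0 ic iS cS.
Qed.

(* The survival factor of the last row of a block vanishes; as it is never used in that
   block it may be replaced by 1, which makes the division in [staircase_mle_param] safe. *)
Lemma staircase_mle_param : exists s t', forall c : state,
  staircase_mle c = s (val c).1 * t' (val c).2.
Proof.
pose h i := if survival i == 0 then 1 else survival i.
have h0 i : h i != 0 by rewrite /h; case: ifP => [_|->//]; apply: oner_neq0.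
(* If [(i, j)] is a state, the staircase condition makes these the rows [k >= i] with [(k, j)] in
   [S], whatever [j] is. The product over the rows above [i] is thus a factor of the column divided
   by a factor of the row. *)
pose below (i k : 'I_m) := (i <= k)%N && [forall j, ((i, j) \in S) ==> ((k, j) \in S)].
exists (fun i => r i / (N * t i) / \prod_(k | below i k) h k).
exists (fun j => col_sum x j * \prod_(k | (k, j) \in S) h k) => c.
have cS : ((val c).1, (val c).2) \in S by rewrite -surjective_pairing (valP c).
set i := (val c).1; set j := (val c).2; rewrite -/i -/j in cS.
have -> : \prod_(k | (k, j) \in S) h k =
    \prod_(k : 'I_m | (k < i)%N && ((k, j) \in S)) survival k * \prod_(k | below i k) h k.
  rewrite (bigID (fun k : 'I_m => (k < i)%N)) /=; congr (_ * _).
    apply: eq_big => k; first by rewrite andbC.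
    move=> /andP[kS ki]; rewrite /h ifN //.
    by rewrite gt_eqF // (survival_gt0 ki kS cS).
  apply: eq_bigl => k; rewrite -leqNgt andbC /below; case: leqP => //= ik.
  apply/idP/forallP => [kS j'|/(_ j)]; last by rewrite cS.
  apply/implyP => ij'; move: ik; rewrite leq_eqVlt => /orP[/eqP/val_inj <-//|ik].
  exact: staircase ik cS kS ij'.
rewrite /staircase_mle /rest -/i -/j; set P := \prod_(k | below i k) h k.
have P0 : P != 0 by apply/prodf_neq0 => k _.
have t0 : t i != 0 by rewrite gt_eqF ?(tail_gt0 cS).
have N0 : N != 0 by rewrite gt_eqF ?total_gt0.
by field; rewrite P0 t0 N0.
Qed.

End Weights.

Lemma staircase_mle_model (R : realType) (x : state -> R) : (forall c, 0 < x c) ->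
  S != set0 -> qi_model (staircase_mle x).
Proof.
move=> x0 S0; split; first exact: staircase_mle_param.
split=> [c|]; first by rewrite ltW ?staircase_mle_gt0.
have N0 : \sum_c x c != 0 by rewrite gt_eqF ?total_gt0.
rewrite -sum_row_sum; apply: (mulIf N0); rewrite mul1r mulr_suml -[RHS]sum_row_sum.
by apply: eq_bigr => i _; rewrite staircase_mle_row.
Qed.

End Staircase.

(** * The estimate as a rational function of the data *)

Section Rationality.
Variables (R : realType) (m n : nat) (S : {set 'I_m * 'I_n}).
Local Notation state := {c in S}.
Local Notation data_poly := {mpoly R[#|{: state}|]}.

Let X (c : state) : data_poly := 'X_(enum_rank c).

Lemma at_data_sum (P : pred state) (u : state -> nat) :
  at_data (\sum_(c | P c) X c) u = \sum_(c | P c) (u c)%:R.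
Proof.
rewrite /at_data raddf_sum; apply: eq_bigr => c _.
by rewrite /X /= mevalXU enum_rankK.
Qed.

Lemma at_data_row i u : at_data (row_sum X i) u = row_sum (fun c => (u c)%:R) i.
Proof. exact: at_data_sum. Qed.

Lemma at_data_col j u : at_data (col_sum X j) u = col_sum (fun c => (u c)%:R) j.
Proof. exact: at_data_sum. Qed.

Lemma at_data_tail i u : at_data (tail_sum X i) u = tail_sum (fun c => (u c)%:R) i.
Proof. exact: at_data_sum. Qed.

Lemma at_data_prod (I : finType) (P : pred I) (F : I -> data_poly) (u : state -> nat) :
  at_data (\prod_(i | P i) F i) u = \prod_(i | P i) at_data (F i) u.
Proof. by rewrite /at_data rmorph_prod. Qed.

(** The closed form is built from margins and tail sums, which are linear in the data; evaluating
    them at the variables gives numerator and denominator. *)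
Lemma staircase_rational_mle :
  (forall (i i' : 'I_m) (j j' : 'I_n), (i < i')%N ->
    (i, j) \in S -> (i', j) \in S -> (i, j') \in S -> (i', j') \in S) ->
  has_rational_mle R S.
Proof.
move=> stair.
have mle (u : state -> nat) : S != set0 -> (forall c, (0 < u c)%N) ->
    is_mle u (staircase_mle (fun c => (u c)%:R : R)) /\
    forall q : state -> R, is_mle u q -> q =1 staircase_mle (fun c => (u c)%:R).
  move=> S0 u0; have x0 c : 0 < (u c)%:R :> R by rewrite ltr0n.
  apply: margins_mle => //.
  - exact: total_gt0.
  - exact: staircase_mle_row.
  - exact: staircase_mle_col.
  - exact: staircase_mle_model.
  - exact: staircase_mle_gt0.
split=> [S0 u u0|]; first by exists (staircase_mle (fun c => (u c)%:R)); case: (mle u S0 u0).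
(* The common factor [\prod_c X c] makes the denominators vanish at data with a zero count,
   where the estimate may exist without being unique. *)
pose above (c : state) (k : 'I_m) := (k < (val c).1)%N && ((k, (val c).2) \in S).
exists (fun c => (\prod_c X c) * (col_sum X (val c).2 * row_sum X (val c).1 *
  \prod_(k | above c k) (tail_sum X k - row_sum X k))).
exists (fun c => (\prod_c X c) * ((\sum_c X c) * tail_sum X (val c).1 *
  \prod_(k | above c k) tail_sum X k)).
have atX u c : at_data (X c) u = (u c)%:R by rewrite /at_data /X mevalXU enum_rankK.
have atM f g u : at_data (f * g : data_poly) u = at_data f u * at_data g u.
  by rewrite /at_data mevalM.
have g0 (u : state -> nat) (c : state) : (forall c, (0 < u c)%N) ->
  (\sum_c (u c)%:R != 0 :> R) /\ forall k, above c k || (k == (val c).1) ->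
    tail_sum (fun c => (u c)%:R : R) k != 0.
  move=> u0; have x0 d : 0 < (u d)%:R :> R by rewrite ltr0n.
  have S0 : S != set0 by apply/set0Pn; exists (val c); apply: valP.
  split=> [|k]; first by rewrite gt_eqF //; apply: total_gt0.
  have iS : ((val c).1, (val c).2) \in S by rewrite -surjective_pairing (valP c).
  by case/orP => [/andP[_ kS]|/eqP ->]; rewrite gt_eqF // ?(tail_gt0 x0 kS) ?(tail_gt0 x0 iS).
split=> [u u0 c|u p mlep c].
  have [N0 t0] := g0 u c u0.
  rewrite !atM !at_data_prod at_data_sum at_data_tail !mulf_neq0 //.
  - by apply/prodf_neq0 => d _; rewrite atX pnatr_eq0 -lt0n.
  - by rewrite t0 // eqxx orbT.
  - by apply/prodf_neq0 => k kc; rewrite at_data_tail t0 // kc.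
rewrite !atM mulf_eq0 negb_or at_data_prod => /andP[/prodf_neq0 u0 _].
have {}u0 d : (0 < u d)%N by have := u0 d isT; rewrite atX pnatr_eq0 -lt0n.
have S0 : S != set0 by apply/set0Pn; exists (val c); apply: valP.
have [N0 t0] := g0 u c u0.
rewrite (mle u S0 u0).2 // /staircase_mle /rest !at_data_prod.
rewrite at_data_sum at_data_row at_data_col at_data_tail.
set x := fun c => (u c)%:R.
have -> : \prod_(k | above c k) survival x k =
    \prod_(k | above c k) at_data (tail_sum X k - row_sum X k) u /
    \prod_(k | above c k) at_data (tail_sum X k) u.
  rewrite -prodf_div; apply: eq_bigr => k kc.
  rewrite /at_data mevalB -!/(at_data _ u) at_data_row at_data_tail /survival.
  by rewrite mulrBl divff ?t0 ?kc.
have P0 : \prod_(k | above c k) at_data (tail_sum X k) u != 0.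
  by apply/prodf_neq0 => k kc; rewrite at_data_tail t0 // kc.
have X0 : \prod_d at_data (X d) u != 0.
  by apply/prodf_neq0 => d _; rewrite atX pnatr_eq0 -lt0n.
have ti0 := t0 (val c).1; rewrite eqxx orbT in ti0; have {}ti0 := ti0 isT.
field.
by rewrite P0 X0 N0 ti0.
Qed.

End Rationality.

Theorem theorem5p20 (R : realType) (n : nat) (w : 'S_n) :
  Y_toric R[i]%C w -> has_rational_mle R (L w).
Proof.
by move=> /toric_Ess_rank_le1 rk1; apply/staircase_rational_mle/L_staircase.
Qed.
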